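(* Let $T>0$, $L>0$, and let $W^T\in\widetilde H^0$ be such that for every $T^*>T$ $$\int_0^\infty e^{\frac{x^2}{4T^*}}\,\bigl|W^T(x)\bigr|\,dx\le L\sqrt{\frac{T^*}{\pi}}\,\ln\frac{\sqrt{T^*}+\sqrt{T}}{\sqrt{T^*}-\sqrt{T}}.$$ Let $$\omega_n=\frac{n!}{(2n+1)!}\int_0^\infty x^{2n+1}W^T(x)\,dx,\qquad n=0,1,2,\dots.$$ Then $W^T\in\mathcal R_T^L(0)$ if and only if there exists $v\in L^\infty(0,T)$ such that $\|v\|_{L^\infty(0,T)}\le L$ and $$\int_0^T \xi^n v(\xi)\,d\xi=\omega_n,\qquad n=0,1,2,\dots.$$
   Context: $\widetilde H^0$ denotes the closed subspace of all odd functions in $L^2(\mathbb R)$, with the $L^2(\mathbb R)$ norm. States and controls are over one fixed scalar field. For $T>0$ and $L>0$ define $$\mathcal R_T^L(0)=\Big\{W^T\in\widetilde H^0 : \exists v\in L^\infty(0,T),\ \|v\|_{L^\infty(0,T)}\le L,\ W^T(x)=\sqrt{\tfrac{2}{\pi}}\,x\int_0^T e^{-\frac{x^2}{4\xi}}\frac{v(\xi)}{(2\xi)^{3/2}}\,d\xi\Big\}$$ (equality of functions of $x$ in $L^2(\mathbb R)$). This is the set of states reachable in time $T$ from the zero state for the control system $W_t=W_{xx}-2u\delta'$, $x\in\mathbb R$, $t\in(0,T)$, $W(\cdot,0)=0$, with controls $u\in L^\infty(0,T)$ satisfying $\|u\|_{L^\infty(0,T)}\le L$ (where $v(\xi)=u(T-\xi)$).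 *)

(* Defs.v *)
From HB Require Import structures.
From mathcomp Require Import all_boot all_order all_algebra.
From mathcomp Require Import all_classical all_reals all_analysis.
From mathcomp Require Import complex.

Set Implicit Arguments.
Unset Strict Implicit.
Unset Printing Implicit Defensive.

Import Order.TTheory GRing.Theory Num.Theory.
Import numFieldNormedType.Exports.
Local Open Scope classical_set_scope.
Local Open Scope ring_scope.
Local Open Scope complex_scope.

(* States and controls share one scalar field, R or C.  Both cases are treated
   at once: functions take values in R[i], and in the real case their values
   are required to lie in the copy of R inside R[i]. *)
Variant scalar_field := RealScalars | ComplexScalars.

Definition scalars (R : realType) (k : scalar_field) : set R[i] :=
  match k with
  | RealScalars => range (real_complex R)
  | ComplexScalars => setT
  end.

(* The library integrates only real and extended-real functions, hence the
   componentwise integral. *)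
Definition Cintegral (R : realType) (D : set R) (f : R -> R[i]) : R[i] :=
  (\int[lebesgue_measure]_(x in D) complex.Re (f x)) +i*
  (\int[lebesgue_measure]_(x in D) complex.Im (f x)).

(* The modulus as an element of R: in R[i], `|z| is again a complex number. *)
Definition modulus (R : realType) (z : R[i]) : R := complex.Re `|z|.

(* The norm of L^p(D): the L^p(R) norm of the extension by zero. *)
Definition Lp_norm (R : realType) (p : \bar R) (D : set R) (f : R -> R[i]) :
    \bar R :=
  Lnorm (@lebesgue_measure R) p (EFin \o ((@modulus R \o f) \_ D)).

(* Representatives of the classes of L^p(D); values outside D are ignored. *)
Definition Lp (R : realType) (k : scalar_field) (p : \bar R) (D : set R) :
    set (R -> R[i]) :=
  [set f | [/\ forall x, D x -> scalars k (f x),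
               measurable_fun D (fun x => complex.Re (f x)),
               measurable_fun D (fun x => complex.Im (f x)) &
               (Lp_norm p D f < +oo)%E] ].

Definition odd_L2 (R : realType) (k : scalar_field) : set (R -> R[i]) :=
  [set W | Lp k 2%:E setT W /\
           \forall x \ae (@lebesgue_measure R), W (- x) = - W x].

(* At the single point x = 0 the integral may diverge; this is immaterial since
   the equality is only required almost everywhere. *)
Definition reachable_from_zero (R : realType) (k : scalar_field) (T L : R) :
    set (R -> R[i]) :=
  [set W | odd_L2 k W /\
    exists v : R -> R[i],
      [/\ Lp k +oo%E `]0, T[ v,
          (Lp_norm +oo%E `]0%R, T[ v <= L%:E)%E &
          \forall x \ae (@lebesgue_measure R),
            W x = (Num.sqrt (2 / pi) * x)%:C *
              Cintegral `]0, T[ (fun xi =>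
                (expR (- (x ^+ 2 / (4 * xi))))%:C * v xi /
                ((2 * xi) `^ (3 / 2))%:C)] ].

Definition omega (R : realType) (W : R -> R[i]) (n : nat) : R[i] :=
  (n`!%:R / (2 * n + 1)`!%:R) *
  Cintegral `]0, +oo[ (fun x => (x ^+ (2 * n + 1))%:C * W x).

(* Main.v *)
(* A state of the form [heat_state T v] has, by Fubini and the Gaussian moments,
   the odd moments (2n+1)!/n! times the moments of v; this is the direct
   implication.  For the converse, the growth hypothesis makes
   G(x) = x (W(x) - heat_state T v x) integrable against exp(a x^2) on x > 0 for
   some a > 0, and all its even moments vanish.  Expanding exp(-s x^2) for
   0 <= s < a keeps this property for exp(-s x^2) G, so iterating gives
   int exp(-s x^2) G = 0 for every s >= 0.  The functions
   (1 - exp(-n r x^2))^(2^n) are combinations of such exponentials and converge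
   boundedly to the indicator of {exp(-r x^2) < 1/2}, so G has integral zero over
   every half-line and vanishes almost everywhere; oddness settles x < 0. *)
Require Import Defs.
From HB Require Import structures.
From mathcomp Require Import all_boot all_order all_algebra.
From mathcomp Require Import all_classical all_reals all_analysis.
From mathcomp Require Import complex.
From mathcomp Require Import measurable_realfun ess_sup_inf.
From mathcomp Require Import ring lra.

Set Implicit Arguments.
Unset Strict Implicit.
Unset Printing Implicit Defensive.

Import Order.TTheory GRing.Theory Num.Theory.
Import numFieldNormedType.Exports.
Local Open Scope classical_set_scope.
Local Open Scope ring_scope.

(** * Gaussian moments *)

(** For m > 0 put c = min(1, e/m): then c|x| <= c(1 + x^2) <= 1 + (e/m) x^2 <= exp((e/m) x^2), and
    taking m-th powers gives C = c^(-m). *)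
Lemma exprn_le_expR_sqr (R : realType) (e : R) (m : nat) : 0 < e ->
  exists2 C, 0 < C & forall x : R, `|x| ^+ m <= C * expR (e * x ^+ 2).
Proof.
move=> e0; case: m => [|m].
  exists 1 => // x; rewrite expr0 mul1r (le_trans _ (expR_ge1Dx _))//.
  by rewrite lerDl mulr_ge0 ?sqr_ge0// ltW.
pose c := Num.min 1 (e / m.+1%:R).
have c0 : 0 < c by rewrite lt_min ltr01 divr_gt0.
exists (c ^- m.+1) => [|x]; first by rewrite invr_gt0 exprn_gt0.
rewrite mulrC ler_pdivlMr ?exprn_gt0// -exprMn.
rewrite [e * _](_ : _ = e / m.+1%:R * x ^+ 2 * m.+1%:R); last by rewrite mulrAC divfK ?pnatr_eq0.
rewrite expRM_natr lerXn2r ?nnegrE ?expR_ge0 ?mulr_ge0// ?(ltW c0)//.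
apply: le_trans (expR_ge1Dx _).
apply: (@le_trans _ _ (c * (1 + x ^+ 2))).
  rewrite mulrC ler_pM2l//; have := real_normK (num_real x); set y := `|x| => <-.
  by have := sqr_ge0 (y - 1); nra.
rewrite mulrDr mulr1 lerD// ?ge_min ?lexx//.
by rewrite ler_wpM2r ?sqr_ge0// /c ge_min lexx orbT.
Qed.

Section gauss_moments.
Variable R : realType.
Local Notation mu := (@lebesgue_measure R).
Variable s : R.
Hypothesis s0 : 0 < s.

Lemma is_derive_gauss_scaled (x : R) :
  is_derive x 1 (fun x => expR (- (s * x ^+ 2))) (- (2 * s * x * expR (- (s * x ^+ 2)))).
Proof.
apply: is_derive_eq; rewrite /GRing.scale/=.
by ring.
Qed.

Lemma continuous_gauss_scaled : continuous (fun x : R => expR (- (s * x ^+ 2))).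
Proof.
move=> x; apply: differentiable_continuous; apply/derivable1_diffP.
by case: (is_derive_gauss_scaled x).
Qed.

Lemma continuous_gauss_monomial n :
  continuous (fun x : R => x ^+ n * expR (- (s * x ^+ 2))).
Proof.
move=> x; apply: cvgM; [exact: exprn_continuous|exact: continuous_gauss_scaled].
Qed.

Lemma measurable_gauss_monomial n D :
  measurable_fun D (fun x : R => x ^+ n * expR (- (s * x ^+ 2))).
Proof.
apply: measurable_funTS; apply: continuous_measurable_fun.
exact: continuous_gauss_monomial.
Qed.

(** Removes the boundary term at infinity when Gaussian moments are integrated by parts. *)
Lemma cvg_gauss_monomial n :
  (k%:R ^+ n * expR (- (s * k%:R ^+ 2)) : R) @[k --> \oo] --> 0.
Proof.
have [C C0 leC] := exprn_le_expR_sqr n (divr_gt0 s0 (ltr0Sn _ 1)).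
(* Half of the exponent absorbs k^n; for k >= 1 the remaining exp(-(s/2) k^2) is at most exp(-(s/2)
   k). *)
apply: (@squeeze_cvgr _ _ _ _ (fun=> 0) (fun k : nat => C * expR (- (s / 2 * k%:R)))).
- near=> k; rewrite mulr_ge0 ?expR_ge0//=.
  apply: (@le_trans _ _ (C * expR (s / 2 * k%:R ^+ 2) * expR (- (s * k%:R ^+ 2)))).
    by rewrite ler_wpM2r ?expR_ge0// -[X in X ^+ n]ger0_norm.
  rewrite -mulrA -expRD ler_pM2l// ler_expR.
  have : (1:R) <= k%:R by rewrite ler1n; near: k; exact: nbhs_infty_gt.
  by set y := k%:R => y1; have := mulr_ge0 (ltW s0) (ler0n R k); rewrite -/y; nra.
- exact: cvg_cst.
- rewrite -[X in _ --> X](mulr0 C); apply: cvgM; first exact: cvg_cst.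
  have lim : expR (- (s / 2 * x)) @[x --> +oo] --> (0 : R).
    apply: (cvg_comp (fun x => s / 2 * x) (fun x => expR (- x)) _ (@cvgr_expR R)).
    by apply: gt0_cvgMry; [exact: divr_gt0|exact: cvg_id].
  exact: (cvg_comp (fun k : nat => k%:R) _ (@cvgr_idn R) lim).
Unshelve. all: by end_near. Qed.

(** Substitution x -> sqrt(s) x in the standard Gaussian integral. *)
Lemma integral_gauss_scaled :
  (\int[mu]_(x in `[0%R, +oo[) (expR (- (s * x ^+ 2)))%:E = (Num.sqrt (pi / s) / 2)%:E)%E.
Proof.
pose r := Num.sqrt s; have r0 : 0 < r by rewrite sqrtr_gt0.
have r2 : r ^+ 2 = s by rewrite sqr_sqrtr// ltW.
have dF (x : R) : is_derive x 1 (fun x => r * x) r.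
  by apply: is_derive_eq; rewrite /GRing.scale/= mulr1.
have F'E : (fun x : R => r * x)^`()%classic = cst r.
  by apply/funext => x; rewrite derive1E; have [_ ->] := dF x.
have H := @increasing_ge0_integration_by_substitutiony R (fun x => r * x) gauss_fun 0.
rewrite mulr0 in H.
have := @integral0y_gauss R; rewrite {}H; last first.
- by move=> x _; exact: gauss_fun_ge0.
- by apply: continuous_subspaceT; exact: continuous_gauss_fun.
- by apply: gt0_cvgMry => //; exact: cvg_id.
- split; first by move=> x _; case: (dF x).
  apply: cvgM; [exact: cvg_cst|exact: cvg_at_right_filter].
- by rewrite F'E; apply/cvg_ex; exists r; exact: cvg_cst.
- by rewrite F'E; apply/cvg_ex; exists r; exact: cvg_cst.
- by rewrite F'E => x _; exact: cvg_cst.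
- by move=> x y _ _ xy; rewrite ltr_pM2l.
rewrite F'E.
rewrite (@eq_integral _ _ _ mu _
    (fun x => (r%:E * (expR (- (s * x ^+ 2)))%:E)%E)); last first.
  by move=> x _; rewrite -EFinM -r2 -exprMn mulrC.
rewrite ge0_integralZl//=.
- move=> /(congr1 (fun z => (r^-1)%:E * z)%E); rewrite muleA -EFinM mulVf ?gt_eqF// mul1e => ->.
  by rewrite -EFinM; congr EFin; rewrite sqrtrM ?pi_ge0// sqrtrV ?ltW// -/r; field; rewrite gt_eqF.
- apply: measurable_funTS; apply/measurable_EFinP; apply: continuous_measurable_fun.
  exact: continuous_gauss_scaled.
- by rewrite lee_fin ltW.
Qed.

(** Integration by parts of x^(2n+1) against -exp(-s x^2), whose derivative brings the factor 2 s x.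
    The boundary term at 0 vanishes because 2n+1 > 0. *)
Lemma gauss_moment_rec_finite n (b : R) : 0 < b ->
  ((2 * s)%:E * \int[mu]_(x in `[0%R, b]) (x ^+ (2 * n.+1) * expR (- (s * x ^+ 2)))%:E =
   ((2 * n + 1)%:R)%:E * \int[mu]_(x in `[0%R, b]) (x ^+ (2 * n) * expR (- (s * x ^+ 2)))%:E
   + (- (b ^+ (2 * n + 1) * expR (- (s * b ^+ 2))))%:E)%E.
Proof.
move=> b0.
pose F x : R := x ^+ (2 * n + 1).
pose G x : R := - expR (- (s * x ^+ 2)).
pose f x : R := (2 * n + 1)%:R * x ^+ (2 * n).
pose g x : R := 2 * s * x * expR (- (s * x ^+ 2)).
have dF (x : R) : is_derive x 1 F (f x).
  have -> : F = id ^+ (2 * n + 1) by apply/funext => y; rewrite exprfctE.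
  apply: is_derive_eq; by rewrite /f addn1/= /GRing.scale/= mulr1.
have dG (x : R) : is_derive x 1 G (g x).
  have := is_deriveN (is_derive_gauss_scaled x); rewrite opprK; exact.
have cT (h : R -> R) (h' : R -> R) : (forall x : R, is_derive x 1 h (h' x)) -> continuous h.
  move=> dh x; apply: differentiable_continuous; apply/derivable1_diffP.
  by case: (dh x).
have dLR (h h' : R -> R) : (forall x : R, is_derive x 1 h (h' x)) ->
    derivable_oo_LRcontinuous h 0 b.
  move=> dh; split; first by move=> x _; case: (dh x).
    by apply: cvg_at_right_filter; exact: cT dh _.
  by apply: cvg_at_left_filter; exact: cT dh _.
have := @integration_by_parts R F G f g 0 b b0 _ (dLR _ _ dF) _ _ (dLR _ _ dG) _.
have -> : (fun x => (F x * g x)%:E) = (fun x => ((2 * s)%:E * (x ^+ (2 * n.+1) * expR (- (s * x ^+ 2)))%:E)%E).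
  apply/funext => x; rewrite -EFinM; congr EFin; rewrite /F /g mulnS addnC !exprD expr1; ring.
have -> : (fun x => (f x * G x)%:E) = (fun x => - (((2 * n + 1)%:R)%:E * (x ^+ (2 * n) * expR (- (s * x ^+ 2)))%:E)%E)%E.
  by apply/funext => x; rewrite -EFinM -EFinN; congr EFin; rewrite /f /G; ring.
have ge0 (m : nat) (x : R) : 0 <= x ^+ (2 * m) * expR (- (s * x ^+ 2)).
  by rewrite mulr_ge0 ?expR_ge0// exprM exprn_ge0// sqr_ge0.
have mm m : measurable_fun `[0, b]%classic (fun x : R => (x ^+ m * expR (- (s * x ^+ 2)))%:E).
  by apply/measurable_EFinP; exact: measurable_gauss_monomial.
rewrite integral_ge0N; last by move=> x _; rewrite -EFinM lee_fin mulr_ge0.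
rewrite !ge0_integralZl//.
2,5: exact: mm.
2,4: by move=> x _; rewrite lee_fin.
2: by rewrite lee_fin mulr_ge0// ltW.
move=> ->.
- by rewrite oppeK addeC /F /G addn1 expr0n/= mul0r subr0 mulrN.
- apply: continuous_subspaceT => x; apply: cvgM; first exact: cvg_cst.
  exact: exprn_continuous.
- by move=> x _; rewrite derive1E; have [_ ->] := dF x.
- apply: continuous_subspaceT => x; apply: cvgM; last exact: continuous_gauss_scaled.
  by apply: cvgM; [exact: cvg_cst|exact: cvg_id].
- by move=> x _; rewrite derive1E; have [_ ->] := dG x.
Qed.

(** Induction on n: the right endpoint in [gauss_moment_rec_finite] runs through the integers to
    infinity. *)
Lemma integral_gauss_moment n :
  (\int[mu]_(x in `[0%R, +oo[) (x ^+ (2 * n) * expR (- (s * x ^+ 2)))%:E =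
   (Num.sqrt (pi / s) / 2 * ((2 * n)`!%:R / (n`!%:R * (4 * s) ^+ n)))%:E)%E.
Proof.
have ge0 (m : nat) (x : R) : 0 <= x ^+ (2 * m) * expR (- (s * x ^+ 2)).
  by rewrite mulr_ge0 ?expR_ge0// exprM exprn_ge0// sqr_ge0.
elim: n => [|n ih].
  under eq_integral do rewrite mul1r.
  by rewrite integral_gauss_scaled muln0 !fact0 expr0 !mulr1 divr1 mulr1.
have lim m := @ge0_cvgn_integral R mu _ (ge0 m) (@measurable_gauss_monomial (2 * m) setT).
set I := (X in _ = X) in ih.
have limr : (((2 * s)^-1)%:E * (((2 * n + 1)%:R)%:E *
    \int[mu]_(x in `[0%R, k%:R]) (x ^+ (2 * n) * expR (- (s * x ^+ 2)))%:E
   + (- (k%:R ^+ (2 * n + 1) * expR (- (s * k%:R ^+ 2))))%:E))%E @[k --> \oo] -->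
   (((2 * s)^-1)%:E * (((2 * n + 1)%:R)%:E * I + (- 0)%:E))%E.
  apply: cvgeZl => //; apply: cvgeD => //.
    by apply: cvgeZl => //; rewrite -ih; exact: lim.
  by apply: cvg_EFin; [exact: nearW|apply: cvgN; exact: cvg_gauss_monomial].
have -> : (Num.sqrt (pi / s) / 2 * ((2 * n.+1)`!%:R / (n.+1`!%:R * (4 * s) ^+ n.+1)))%:E =
    (((2 * s)^-1)%:E * (((2 * n + 1)%:R)%:E * I + (- 0)%:E))%E.
  rewrite /I oppr0 adde0 -!EFinM; congr EFin.
  rewrite mulnS [(2 + _)%N](_ : _ = (2 * n).+2)// !factS !natrM exprS natrD.
  rewrite -!natr1 natrM; field.
  by rewrite !pnatr_eq0 -!lt0n fact_gt0/= expf_neq0 ?gt_eqF ?mulr_gt0// andbT natr1 pnatr_eq0.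
(* Shifting the index makes the endpoint k + 1 positive, as the finite recursion requires. *)
have limS := lim n.+1; rewrite -cvg_shiftS in limS; rewrite -cvg_shiftS in limr.
apply: (cvg_unique (@ereal_hausdorff R) limS); apply: cvg_trans limr.
apply: near_eq_cvg; apply: nearW => k /=.
rewrite -gauss_moment_rec_finite ?ltr0n// muleA -EFinM mulVf ?mul1e//.
by rewrite gt_eqF// mulr_gt0.
Qed.

Lemma integral_gauss_moment_oy n :
  (\int[mu]_(x in `]0%R, +oo[) (x ^+ (2 * n) * expR (- (s * x ^+ 2)))%:E =
   (Num.sqrt (pi / s) / 2 * ((2 * n)`!%:R / (n`!%:R * (4 * s) ^+ n)))%:E)%E.
Proof.
rewrite integral_itv_obnd_cbnd ?integral_gauss_moment//.
by apply/measurable_EFinP; exact: measurable_gauss_monomial.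
Qed.

End gauss_moments.

(** * Exponentially integrable functions with vanishing moments *)

Lemma exprn_le_expR (R : realType) n (e : R) : 0 < e ->
  exists2 C, 0 < C & forall t : R, 0 <= t -> t ^+ n <= C * expR (e * t).
Proof.
move=> e0; have [C C0 leC] := exprn_le_expR_sqr (2 * n) e0.
exists C => // t t0; have := leC (Num.sqrt t).
by rewrite ger0_norm ?sqrtr_ge0// exprM sqr_sqrtr.
Qed.

(** Termwise comparison with the series of exp t, whose partial sums increase to their limit. The
    bound is uniform in N, as dominated convergence needs in [moments_expN_eq0]. *)
Lemma norm_series_exp_coeff (R : realType) (t : R) N : 0 <= t ->
  `|series (exp_coeff (- t)) N| <= expR t.
Proof.
move=> t0; apply: (@le_trans _ _ (series (exp_coeff t) N)).
  rewrite /series/= (le_trans (ler_norm_sum _ _ _))// ler_sum// => i _.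
  rewrite /exp_coeff/= normrM normrX normrN (ger0_norm t0).
  by rewrite ger0_norm// invr_ge0.
apply: nondecreasing_cvgn_le; last exact: is_cvg_series_exp_coeff.
by apply: nondecreasing_series => i _ _; exact: exp_coeff_ge0.
Qed.

Section exponentially_integrable.
Context d (X : measurableType d) (R : realType) (mu : {measure set X -> \bar R}).
Variables (D : set X) (y : X -> R) (a : R).
Hypotheses (mD : measurable D) (my : measurable_fun D y).
Hypotheses (y0 : forall x, D x -> 0 <= y x) (a0 : 0 < a).

(** Integrability is absolute, so this bounds the integral of exp(a y)|G|. The application takes y =
    x^2 on the positive half-line. *)
Definition exp_integrable (G : X -> R) :=
  mu.-integrable D (fun x => (expR (a * y x) * G x)%:E).

Lemma exp_integrable_measurable G : exp_integrable G -> measurable_fun D G.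
Proof.
move=> /measurable_int/measurable_EFinP mG.
apply: (eq_measurable_fun (fun x => expR (- (a * y x)) * (expR (a * y x) * G x))).
  by move=> x _; rewrite mulrA [X in X * _]mulrC expRxMexpNx_1 mul1r.
apply: measurable_funM => //; apply: measurableT_comp => //.
by apply: measurable_funN; apply: measurable_funM.
Qed.

Lemma exp_integrable_mul G (h : X -> R) C : exp_integrable G -> measurable_fun D h ->
  (forall x, D x -> `|h x| <= C * expR (a * y x)) ->
  mu.-integrable D (fun x => (h x * G x)%:E).
Proof.
move=> iG mh leh.
apply: (le_integrable mD _ _ (integrableZl mD C iG)).
  apply/measurable_EFinP; apply: measurable_funM => //.
  exact: exp_integrable_measurable.
move=> x Dx; rewrite -EFinM lee_fin !normrM mulrA.
rewrite ler_wpM2r// (le_trans (leh x Dx))//.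
by rewrite (ger0_norm (expR_ge0 _)) ler_wpM2r ?expR_ge0 ?ler_norm.
Qed.

Lemma exp_integrable_bounded_mul G (h : X -> R) : exp_integrable G ->
  measurable_fun D h -> (forall x, D x -> `|h x| <= 1) -> exp_integrable (h \* G).
Proof.
move=> iG mh h1; rewrite /exp_integrable.
rewrite [X in mu.-integrable D X](_ : _ = (fun x => ((expR (a * y x) * h x) * G x)%:E)).
  apply: (@exp_integrable_mul G _ 1) => // [|x Dx].
    apply: measurable_funM => //; apply: measurableT_comp => //.
    exact: measurable_funM.
  by rewrite normrM mul1r (ger0_norm (expR_ge0 _)) ler_piMr ?expR_ge0 ?h1.
by apply/funext => x; rewrite /= mulrA.
Qed.

Lemma measurable_expN s : measurable_fun D (fun x => expR (- (s * y x))).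
Proof.
by apply: measurableT_comp => //; apply: measurable_funN; exact: measurable_funM.
Qed.

Lemma expN_le1 s x : 0 <= s -> D x -> 0 <= expR (- (s * y x)) <= 1.
Proof.
by move=> s0 Dx; rewrite expR_ge0/= expR_le1 oppr_le0 mulr_ge0// y0.
Qed.

Lemma exp_integrable_expN G s : 0 <= s -> exp_integrable G ->
  exp_integrable (fun x => expR (- (s * y x)) * G x).
Proof.
move=> s0 iG; apply: exp_integrable_bounded_mul => // [|x Dx].
  exact: measurable_expN.
by have /andP[e0 e1] := expN_le1 s0 Dx; rewrite ger0_norm.
Qed.

Lemma integrable_of_exp_integrable G : exp_integrable G ->
  mu.-integrable D (EFin \o G).
Proof.
move=> iG; rewrite [X in mu.-integrable D X](_ : _ = (fun x => (cst 1 x * G x)%:E)).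
  apply: (@exp_integrable_mul G _ 1) => // x Dx.
  by rewrite normr1 mul1r -[leLHS]expR0 ler_expR mulr_ge0 ?y0 ?ltW.
by apply/funext => x; rewrite /= mul1r.
Qed.

(** Replace exp(-s y) by its Taylor polynomials. Each resulting integral is a combination of moments
    of G, hence 0, and dominated convergence passes to the limit. *)
Lemma moments_expN_eq0 G s : 0 <= s < a -> exp_integrable G ->
  (forall n, (\int[mu]_(x in D) (y x ^+ n * G x)%:E = 0)%E) ->
  forall n, (\int[mu]_(x in D) (y x ^+ n * (expR (- (s * y x)) * G x))%:E = 0)%E.
Proof.
move=> /andP[s0 sa] iG mom n.
have mG := exp_integrable_measurable iG.
have as0 : 0 < a - s by rewrite subr_gt0.
have [C C0 leC] := exprn_le_expR n as0.
pose S N x := series (exp_coeff (- (s * y x))) N.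
have mS N : measurable_fun D (S N).
  apply: measurable_sum => i; apply: measurable_funM => //.
  by apply: measurable_funX; apply: measurable_funN; exact: measurable_funM.
have leS N x : D x -> `|S N x * y x ^+ n| <= C * expR (a * y x).
  move=> Dx; rewrite normrM mulrC (ger0_norm (exprn_ge0 _ (y0 Dx))).
  (* The gap a - s > 0 absorbs y^n, while exp(s y) bounds the partial sums; together they give
     exactly the weight exp(a y). *)
  apply: (@le_trans _ _ (C * expR ((a - s) * y x) * expR (s * y x))).
    apply: ler_pM => //; first by rewrite exprn_ge0 ?y0.
      by rewrite leC ?y0.
    by rewrite norm_series_exp_coeff// mulr_ge0 ?y0.
  by rewrite -mulrA -expRD mulrBl subrK.
pose f_ N x := (S N x * y x ^+ n * G x)%:E.
pose f x := (y x ^+ n * (expR (- (s * y x)) * G x))%:E.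
pose g x := (C%:E * (expR (a * y x) * `|G x|)%:E)%E.
have if_ N : mu.-integrable D (f_ N).
  apply: (@exp_integrable_mul G _ C) => //; last by move=> x; exact: leS.
  by apply: measurable_funM => //; exact: measurable_funX.
have int0 N : (\int[mu]_(x in D) f_ N x = 0)%E.
  (* Each new Taylor term contributes a multiple of the moment of order N + n. *)
  elim: N => [|N ih].
    rewrite integral0_eq// => x Dx.
    by rewrite /f_ /S /series/= big_geq// !mul0r.
  pose c : R := (- s) ^+ N / N`!%:R.
  have fS : f_ N.+1 = (fun x => f_ N x + c%:E * (y x ^+ (N + n) * G x)%:E)%E.
    apply/funext => x; rewrite /f_ -EFinM -EFinD; congr EFin.
    rewrite /S seriesS/= addrC /exp_coeff/= 2!mulrDl; congr (_ + _).
    by rewrite /c -mulNr exprMn exprD; ring.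
  have iy : mu.-integrable D (fun x => (y x ^+ (N + n) * G x)%:E).
    have [C' C'0 leC'] := exprn_le_expR (N + n) a0.
    apply: (@exp_integrable_mul G _ C') => //; first exact: measurable_funX.
    by move=> x Dx; rewrite ger0_norm ?leC' ?exprn_ge0 ?y0.
  by rewrite fS integralD ?ih ?integralZl ?mom ?mule0 ?adde0//; exact: integrableZl.
have [] := @dominated_convergence _ _ _ mu D mD f_ f g.
- by move=> N; exact: (measurable_int mu (if_ N)).
- apply/measurable_EFinP; apply: measurable_funM; first exact: measurable_funX.
  by apply: measurable_funM => //; exact: measurable_expN.
- apply: aeW => x Dx; apply: cvg_EFin; first exact: nearW.
  rewrite [X in _ --> X](_ : _ = expR (- (s * y x)) * y x ^+ n * G x); last by ring.
  apply: cvgM; last exact: cvg_cst.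
  apply: cvgM; last exact: cvg_cst.
  exact: is_cvg_series_exp_coeff.
- apply: integrableZl => //.
  rewrite (_ : (fun x => _) = (fun x => `|(expR (a * y x) * G x)%:E|)%E).
    exact: integrable_abse.
  by apply/funext => x; rewrite abse_EFin normrM (ger0_norm (expR_ge0 _)).
- apply: aeW => x N Dx; rewrite /g -EFinM lee_fin normrM mulrA ler_wpM2r//.
  exact: leS.
move=> _ _ /cvg_lim <-//.
by rewrite (_ : [sequence _]_N = cst 0%E) ?lim_cst//; apply/funext => N; exact: int0.
Qed.

(** [moments_expN_eq0] reaches only s < a, but multiplication by exp(-q y) preserves both
    exponential integrability with the same a and the vanishing of all moments. It can therefore be
    iterated. *)
Lemma laplace_eq0 G s : 0 <= s -> exp_integrable G ->
  (forall n, (\int[mu]_(x in D) (y x ^+ n * G x)%:E = 0)%E) ->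
  (\int[mu]_(x in D) (expR (- (s * y x)) * G x)%:E = 0)%E.
Proof.
move=> s0 iG mom.
(* m exceeds s/a, so s splits into m equal steps q = s/m < a. *)
pose m := (Num.truncn (s / a)).+1; pose q := s / m%:R.
have m0 : (0 : R) < m%:R by rewrite ltr0n.
have q0a : 0 <= q < a.
  rewrite /q divr_ge0//= ltr_pdivrMr// mulrC -ltr_pdivrMr//.
  by rewrite truncnS_gt// divr_ge0// ltW.
have /andP[q0 _] := q0a.
have step k n :
    (\int[mu]_(x in D) (y x ^+ n * (expR (- (q * k%:R * y x)) * G x))%:E = 0)%E.
  elim: k n => [|k ih] n.
    by under eq_integral do rewrite mulr0 mul0r oppr0 expR0 mul1r.
  have qk0 : 0 <= q * k%:R by rewrite mulr_ge0.
  have := moments_expN_eq0 q0a (exp_integrable_expN qk0 iG) ih n.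
  under eq_integral do rewrite [X in _ * X]mulrA -expRD -opprD -mulrDl -{1}[q]mulr1 -mulrDr nat1r.
  by [].
have := step m 0; rewrite divfK ?gt_eqF//.
by under eq_integral do rewrite expr0 mul1r.
Qed.

(** One more factor 1 - exp(-r y) is a difference of two integrals of order j, with parameters s and
    r + s; hence the induction on j for all s at once. *)
Lemma laplace_onem_exprn_eq0 G r s j : 0 <= r -> 0 <= s -> exp_integrable G ->
  (forall n, (\int[mu]_(x in D) (y x ^+ n * G x)%:E = 0)%E) ->
  (\int[mu]_(x in D)
     ((1 - expR (- (r * y x))) ^+ j * (expR (- (s * y x)) * G x))%:E = 0)%E.
Proof.
move=> r0 + iG mom; elim: j s => [|j ih] s s0.
  by under eq_integral do rewrite expr0 mul1r; exact: laplace_eq0.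
have int t : 0 <= t -> mu.-integrable D (fun x =>
    ((1 - expR (- (r * y x))) ^+ j * (expR (- (t * y x)) * G x))%:E).
  move=> t0; apply: integrable_of_exp_integrable.
  apply: (exp_integrable_bounded_mul (exp_integrable_expN t0 iG)).
    by apply: measurable_funX; apply: measurable_funB => //; exact: measurable_expN.
  move=> x Dx; have /andP[e0 e1] := expN_le1 r0 Dx.
  by rewrite normrX exprn_ile1// ger0_norm; lra.
have rs0 : 0 <= r + s by rewrite addr_ge0.
have := integralB mD (int s s0) (int (r + s) rs0).
rewrite !ih// sube0 => <-; apply: eq_integral => x _; rewrite -EFinB; congr EFin.
by rewrite mulrDl opprD expRD exprSr; ring.
Qed.

End exponentially_integrable.

(** * Approximation of half-line indicators, and uniqueness from even moments *)

Lemma onem_exprn_ge (R : realDomainType) (q : R) n : 0 <= q <= 1 ->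
  1 - n%:R * q <= (1 - q) ^+ n.
Proof.
move=> /andP[q0 q1]; elim: n => [|n ih]; first by rewrite mul0r subr0.
rewrite exprSr; apply: (@le_trans _ _ ((1 - n%:R * q) * (1 - q))).
  by rewrite -natr1; have := mulr_ge0 (ler0n R n) (sqr_ge0 q); nra.
by rewrite ler_wpM2r ?subr_ge0.
Qed.

(** Bernoulli gives n q <= 1 + n q <= (1 + q)^n, and (1 - q)^n (1 + q)^n = (1 - q^2)^n <= 1. *)
Lemma onem_exprn_mul_le1 (R : realDomainType) (q : R) n : 0 <= q <= 1 ->
  (1 - q) ^+ n * (n%:R * q) <= 1.
Proof.
move=> /andP[q0 q1].
apply: (@le_trans _ _ ((1 - q) ^+ n * (1 + q) ^+ n)).
  rewrite ler_wpM2l ?exprn_ge0 ?subr_ge0//.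
  elim: n => [|n ih]; first by rewrite mul0r.
  rewrite exprS -natr1; apply: (@le_trans _ _ ((1 + q) * (1 + n%:R * q) )).
    by have := mulr_ge0 (ler0n R n) (sqr_ge0 q); nra.
  rewrite ler_wpM2l ?addr_ge0//.
  elim: {ih}n => [|n ih]; first by rewrite mul0r addr0.
  rewrite exprS -natr1; apply: le_trans (ler_wpM2l _ ih); last by rewrite addr_ge0.
  by have := mulr_ge0 (ler0n R n) (sqr_ge0 q); nra.
by rewrite -exprMn exprn_ile1//; nra.
Qed.

(* The threshold is 1/2 because (2 ^ n) u ^ n = (2 u) ^ n tends to 0 or to
   infinity according as u < 1/2 or u > 1/2. *)
Lemma cvg_onem_exprn_exprn (R : realType) (u : R) : 0 <= u <= 1 -> u != 2^-1 ->
  (1 - u ^+ n) ^+ (2 ^ n)%N @[n --> \oo] --> ((u < 2^-1)%R%:R : R).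
Proof.
move=> /andP[u0 u1] u12.
have un n : 0 <= u ^+ n <= 1 by rewrite exprn_ge0//= exprn_ile1.
have un2 n : (2 ^ n)%N%:R * u ^+ n = (2 * u) ^+ n by rewrite natrX exprMn.
have [u2|u2|/eqP] := ltgtP u 2^-1; last by rewrite (negPf u12).
- apply: (@squeeze_cvgr _ _ _ _ (fun n => 1 - (2 * u) ^+ n) (fun=> 1)).
  + apply: nearW => n; rewrite -un2 onem_exprn_ge//=.
    by have /andP[] := un n => ? ?; rewrite exprn_ile1 ?subr_ge0 ?gerBl.
  + rewrite -[X in _ --> X]subr0; apply: cvgB; first exact: cvg_cst.
    by apply: cvg_expr; rewrite ger0_norm; lra.
  + exact: cvg_cst.
- apply: (@squeeze_cvgr _ _ _ _ (fun=> 0) (fun n => (2 * u)^-1 ^+ n)).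
  + apply: nearW => n; have /andP[? ?] := un n.
    rewrite exprn_ge0 ?subr_ge0//= exprVn -[leRHS]mul1r ler_pdivlMr.
      by rewrite -un2 onem_exprn_mul_le1.
    by rewrite exprn_gt0//; lra.
  + exact: cvg_cst.
  + apply: cvg_expr; rewrite ger0_norm ?invr_ge0 ?invf_lt1; lra.
Qed.

(** With u = exp(-r y), the functions (1 - u^n)^(2^n) tend boundedly to the indicator of {u < 1/2}
    off {u = 1/2}. Each has integral 0 against G, and |G| is an integrable majorant. *)
Lemma superlevel_integral_eq0 d (X : measurableType d) (R : realType)
    (mu : {measure set X -> \bar R}) (D : set X) (y G : X -> R) (a b : R) :
  measurable D -> measurable_fun D y -> (forall x, D x -> 0 <= y x) ->
  0 < a -> exp_integrable mu D y a G ->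
  (forall n, (\int[mu]_(x in D) (y x ^+ n * G x)%:E = 0)%E) ->
  0 < b -> {ae mu, forall x, D x -> y x != b} ->
  (\int[mu]_(x in D) ((b < y x)%R%:R * G x)%:E = 0)%E.
Proof.
move=> mD my y0 a0 iG mom b0 yb.
have mG := exp_integrable_measurable my iG.
(* Chosen so that exp(-r b) = 1/2, which turns {u < 1/2} into {b < y}. *)
pose r := ln 2 / b.
have r0 : 0 <= r by rewrite divr_ge0 ?ln_ge0 ?(ltW b0)//; lra.
have half_lt t : (expR (- (r * t)) < 2^-1) = (b < t).
  rewrite -[X in _ < X]lnK ?posrE// ltr_expR lnV ?posrE// ltrN2 /r.
  by rewrite mulrAC ltr_pdivlMr// ltr_pM2l// ln_gt0; lra.
have half_eq t : t != b -> expR (- (r * t)) != 2^-1.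
  apply: contra_neq => /(congr1 (@ln R)); rewrite expRK lnV ?posrE// => /oppr_inj.
  rewrite /r mulrAC => /(congr1 (fun z => z * b / ln 2)).
  by rewrite divfK ?gt_eqF// mulrAC divff ?mul1r ?[ln 2 * _]mulrC ?mulfK// gt_eqF// ln_gt0; lra.
(* The factor exp(-(0 y)) = 1 gives the shape of [laplace_onem_exprn_eq0] at s = 0; the power u^n is
   written exp(-n r y). *)
pose f_ n x := ((1 - expR (- (n%:R * r * y x))) ^+ (2 ^ n)%N * (expR (- (0 * y x)) * G x))%:E.
pose f x := ((b < y x)%R%:R * G x)%:E.
have [] := @dominated_convergence _ _ _ mu D mD f_ f (fun x => `|(G x)%:E|%E).
- move=> n; apply/measurable_EFinP; apply: measurable_funM.
    by apply: measurable_funX; apply: measurable_funB => //; exact: measurable_expN.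
  by apply: measurable_funM => //; exact: measurable_expN.
- apply/measurable_EFinP; apply: measurable_funM => //.
  apply: (measurable_comp (F := setT)) => //.
  exact: measurable_fun_ltr.
- apply: filterS yb => x yb Dx; apply: cvg_EFin; first exact: nearW.
  rewrite /f_ /f/= mul0r oppr0 expR0 mul1r.
  apply: cvgM; last exact: cvg_cst.
  have := @cvg_onem_exprn_exprn _ _ (expN_le1 y0 r0 Dx) (half_eq _ (yb Dx)).
  rewrite half_lt; apply: cvg_trans; apply: near_eq_cvg; apply: nearW => n.
  by rewrite -expRM_natl mulrN mulrA.
- exact/integrable_abse/(integrable_of_exp_integrable mD my y0 a0 iG).
- apply: aeW => x n Dx; rewrite /f_ mul0r oppr0 expR0 mul1r lee_fin normrM.
  have nr0 : 0 <= n%:R * r by rewrite mulr_ge0.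
  have /andP[e0 e1] := expN_le1 y0 nr0 Dx.
  by rewrite ler_piMl// normrX exprn_ile1// ger0_norm; lra.
move=> _ _ /cvg_lim <-//.
rewrite (_ : [sequence _]_n = cst 0%E) ?lim_cst//; apply/funext => n.
by apply: (laplace_onem_exprn_eq0 mD my y0 a0) => //; rewrite mulr_ge0.
Qed.

(** On x > 0 the superlevel sets of x^2 are half-lines, so the extension of G by zero has an
    identically zero primitive. Almost everywhere differentiation of the primitive then gives G =
    0. *)
Lemma moments_sqr_eq0 (R : realType) (G : R -> R) (a : R) : 0 < a ->
  exp_integrable (@lebesgue_measure R) `]0%R, +oo[ (fun x => x ^+ 2) a G ->
  (forall n, (\int[@lebesgue_measure R]_(x in `]0%R, +oo[) (x ^+ (2 * n) * G x)%:E = 0)%E) ->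
  {ae @lebesgue_measure R, forall x, 0 < x -> G x = 0}.
Proof.
set mu := @lebesgue_measure R; pose D : set (measurableTypeR R) := [set` `]0%R, +oo[].
move=> a0 iG mom; pose y (x : measurableTypeR R) : R := x ^+ 2.
have mD : measurable D by exact: measurable_itv.
have my : measurable_fun D y by exact: exprn_measurable.
have y0 x : D x -> 0 <= y x by rewrite sqr_ge0.
have momy n : (\int[mu]_(x in D) (y x ^+ n * G x)%:E = 0)%E.
  by under eq_integral do rewrite /y -exprM.
have intG := integrable_of_exp_integrable mD my y0 a0 iG.
have tail b : 0 < b -> (\int[mu]_(x in D) ((b ^+ 2 < y x)%R%:R * G x)%:E = 0)%E.
  move=> b0; apply: (superlevel_integral_eq0 mD my y0 a0 iG momy).
    by rewrite exprn_gt0.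
  (* On x > 0 the level set x^2 = b^2 is the single point b. *)
  exists [set b]; split => //; first exact: lebesgue_measure_set1.
  move=> x /= /not_implyP[]; rewrite /D/= in_itv/= andbT => x0 /negP; rewrite negbK.
  by rewrite eqrXn2// ?ltW// => /eqP.
have G0 : (\int[mu]_(x in D) (G x)%:E = 0)%E.
  by have := momy 0%N; under eq_integral do rewrite expr0 mul1r.
have intGT : mu.-integrable setT (EFin \o G \_ D).
  by rewrite -restrict_EFin; apply/(integrable_mkcond _ mD).1.
have prim x : (\int[mu]_(t in `]-oo, x]) ((G \_ D) t)%:E = 0)%E.
  have [x0|x0] := leP x 0.
    apply: integral0_eq => t; rewrite /= in_itv/= => tx; rewrite patchE memNset//.
    by rewrite /D/= in_itv/= andbT => /(le_lt_trans (le_trans tx x0)); rewrite ltxx.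
  (* Write 0 as the integral over the whole half-line minus the tail beyond x; what is left is the
     integral over ]0, x]. *)
  rewrite -[RHS]sube0 -{2}(tail x x0) -G0.
  have itail : mu.-integrable D (fun t => ((x ^+ 2 < y t)%R%:R * G t)%:E).
    apply: (le_integrable mD _ _ intG) => [|t Dt].
      apply/measurable_EFinP; apply: measurable_funM => //.
        apply: (measurable_comp (F := setT)) => //.
        exact: measurable_fun_ltr.
      exact: exp_integrable_measurable iG.
    rewrite lee_fin normrM ler_piMl//.
    by case: (_ < _); rewrite ?normr1 ?normr0.
  rewrite -(integralB mD intG itail) [LHS]integral_mkcond [RHS]integral_mkcond.
  apply: eq_integral => t _; rewrite !patchE /D !mem_setE !in_itv/= andbT.
  have [t0|t0] := ltP 0 t; last by case: ifP.
  have -> : (x ^+ 2 < y t) = (x < t) by rewrite /y ltr_pXn2r// nnegrE ltW.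
  case: (leP t x) => _ /=; first by rewrite mul0r sube0.
  by rewrite mul1r -EFinB subrr.
have := @FTC1Ny R (G \_ D) _ (integrable_locally mD intG).
rewrite -/mu => /(_ _)[].
  by move=> z; exact: integrableS intGT.
move=> N [mN N0 subN]; exists N; split => //; apply: subset_trans subN => x /= nG dF.
apply: nG => x0; have [_] := dF.
rewrite (_ : (fun x => _) = cst 0) ?derive1_cst; last first.
  by apply/funext => z; rewrite /Rintegral prim.
by rewrite patchE mem_set// /D/= in_itv/= x0.
Qed.

(** * The heat kernel and Fubini *)

(** For x different from 0, 1/x = x (x^2)^(-1), and at 0 both sides are 0 by the convention for the
    inverse. The power function is known to be measurable. *)
Lemma measurable_invr (R : realType) : measurable_fun [set: R] (@GRing.inv R).
Proof.
rewrite (_ : GRing.inv = fun x : R => x * (x ^+ 2) `^ (-1)).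
  apply: measurable_funM => //.
  by apply: (measurableT_comp (measurable_powR _)).
apply/funext => x; rewrite powR_inv1 ?sqr_ge0//.
have [->|x0] := eqVneq x 0; first by rewrite invr0 mul0r.
by field.
Qed.

Lemma powR32 (R : realType) (z : R) : 0 <= z -> z `^ (3 / 2) = Num.sqrt z ^+ 3.
Proof.
by move=> z0; rewrite mulrC powRrM powR12_sqrt// powR_mulrn ?sqrtr_ge0.
Qed.

(** Multiplied by sqrt(2/pi) x, this is -2 times the x-derivative of the Gaussian heat kernel
    exp(-x^2/(4 xi)) / sqrt(4 pi xi). *)
Definition heat_kernel (R : realType) (x xi : R) : R :=
  expR (- (x ^+ 2 / (4 * xi))) / ((2 * xi) `^ (3 / 2)).

(** Real-valued: complex states are treated through their real and imaginary parts. *)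
Definition heat_state (R : realType) (T : R) (v : R -> R) (x : R) : R :=
  Num.sqrt (2 / pi) * x *
    \int[@lebesgue_measure R]_(xi in `]0, T[) (heat_kernel x xi * v xi).

Section heat_fubini.
Variable R : realType.
Local Notation mu := (@lebesgue_measure R).
Local Notation D := ([set` `]0%R, +oo[] : set (measurableTypeR R)).

Lemma heat_kernel_ge0 (x xi : R) : 0 <= heat_kernel x xi.
Proof. by rewrite divr_ge0 ?expR_ge0 ?powR_ge0. Qed.

Lemma measurable_heat_kernel :
  measurable_fun setT (fun z : measurableTypeR R * measurableTypeR R => heat_kernel z.1 z.2).
Proof.
apply: measurable_funM.
  apply: measurableT_comp => //; apply: measurable_funN; apply: measurable_funM.
    by apply: measurable_funX; exact: measurable_fst.
  apply: (measurableT_comp (@measurable_invr R)).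
  by apply: measurable_funM => //; exact: measurable_snd.
apply: (measurableT_comp (@measurable_invr R)).
apply: (measurableT_comp (measurable_powR _)).
by apply: measurable_funM => //; exact: measurable_snd.
Qed.

(** With z = (2 xi)^(-1/2) the kernel is z^3 exp(-(x^2/2) z^2), bounded in z by
    [exprn_le_expR_sqr]. *)
Lemma heat_kernel_bounded (x : R) : 0 < x ->
  exists2 C, 0 < C & forall xi, 0 < xi -> heat_kernel x xi <= C.
Proof.
move=> x0.
have [|C C0 leC] := @exprn_le_expR_sqr R (x ^+ 2 / 2) 3; first by rewrite divr_gt0 ?exprn_gt0.
exists C => // xi xi0; have s0 : 0 < Num.sqrt (2 * xi) by rewrite sqrtr_gt0 mulr_gt0.
have := leC (Num.sqrt (2 * xi))^-1; rewrite normrV ?unitfE ?gt_eqF// gtr0_norm// !exprVn.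
rewrite sqr_sqrtr ?mulr_ge0 ?(ltW xi0)// => le3.
rewrite /heat_kernel powR32 ?mulr_ge0 ?(ltW xi0)// expRN mulrC ler_pdivrMr ?expR_gt0//.
by rewrite [x ^+ 2 / (4 * xi)](_ : _ = x ^+ 2 / 2 / (2 * xi))//; field; rewrite gt_eqF.
Qed.

(** Used with b = 4, the kernel itself, to compute moments, and with b = 8, half the Gaussian decay,
    to bound integrals. *)
Lemma integral_gauss_heat (xi b : R) n : 0 < xi -> 0 < b ->
  (\int[mu]_(x in D) (x ^+ (2 * n.+1) * expR (- ((b * xi)^-1 * x ^+ 2)) / (2 * xi) `^ (3 / 2))%:E =
   (Num.sqrt (pi * b / 2) * (b / 8) * ((2 * n + 1)`!%:R / n`!%:R * (b * xi / 4) ^+ n))%:E)%E.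
Proof.
move=> xi0 b0; pose r := Num.sqrt (2 * xi).
have bxi0 : 0 < (b * xi)^-1 by rewrite invr_gt0 mulr_gt0.
have r0 : 0 < r by rewrite sqrtr_gt0 mulr_gt0.
have r2 : r ^+ 2 = 2 * xi by rewrite sqr_sqrtr// mulr_ge0 ?ltW.
have pow : (2 * xi) `^ (3 / 2) = r ^+ 3 by rewrite powR32// mulr_ge0 ?ltW.
under eq_integral do rewrite mulrC EFinM.
rewrite ge0_integralZl//; last 3 first.
- by apply/measurable_EFinP; exact: measurable_gauss_monomial.
- by move=> x _; rewrite lee_fin mulr_ge0 ?expR_ge0// exprM exprn_ge0 ?sqr_ge0.
- by rewrite lee_fin invr_ge0 powR_ge0.
rewrite integral_gauss_moment_oy// -EFinM; congr EFin; rewrite pow invrK.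
have -> : Num.sqrt (pi * (b * xi)) = Num.sqrt (pi * b / 2) * r.
  rewrite /r -sqrtrM; first by congr Num.sqrt; field.
  by rewrite !mulr_ge0 ?pi_ge0 ?(ltW b0).
have -> : 4 / (b * xi) = (b * xi / 4)^-1 by rewrite invf_div.
set u := b * xi / 4.
have -> : b / 8 = u / r ^+ 2 by rewrite r2 /u; field; rewrite gt_eqF.
have u0 : u != 0 by rewrite gt_eqF// /u divr_gt0// mulr_gt0.
rewrite mulnS [(2 + _)%N](_ : _ = (2 * n + 1).+1); last by rewrite addnC !addnS.
rewrite exprVn [u ^+ n.+1]exprS !factS !natrM -[(2 * n + 1).+1%:R]natr1 natrD natrM -[n.+1%:R]natr1.
field.
by rewrite u0 expf_neq0// natr1 !pnatr_eq0 -!lt0n fact_gt0 gt_eqF.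
Qed.

Lemma measurable_heat_kernelx (xi : R) (A : set R) :
  measurable_fun (A : set (measurableTypeR R)) (fun x => heat_kernel x xi).
Proof.
by apply: measurable_funTS; apply: (measurableT_comp measurable_heat_kernel (measurable_pair2 xi)).
Qed.

Lemma measurable_heat_kernelxi (x : R) (A : set R) :
  measurable_fun (A : set (measurableTypeR R)) (fun xi => heat_kernel x xi).
Proof.
by apply: measurable_funTS; apply: (measurableT_comp measurable_heat_kernel (measurable_pair1 x)).
Qed.

Variables (T C M : R) (phi v : R -> R).
Local Notation I := ([set` `]0%R, T[] : set (measurableTypeR R)).
Hypotheses (T0 : 0 < T) (mphi : measurable_fun D phi).
Hypothesis phiC : forall x, 0 < x -> `|phi x| <= C * (x * expR ((8 * T)^-1 * x ^+ 2)).
Hypotheses (mv : measurable_fun I v) (vM : forall xi, I xi -> `|v xi| <= M).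

Let c : R := Num.sqrt (2 / pi).
Let phi1 x := phi x * (c * x).

(** Half of the exponent x^2/(4 xi) pays for the growth exp(x^2/(8T)) of [phi], since xi < T; the
    other half remains. *)
Lemma heat_integrand_le (x xi : R) : 0 < x -> I xi ->
  `|phi1 x * heat_kernel x xi| <=
  c * C * (x ^+ (2 * 1) * expR (- ((8 * xi)^-1 * x ^+ 2)) / (2 * xi) `^ (3 / 2)).
Proof.
rewrite /= in_itv/= => x0 /andP[xi0 xiT]; have c0 : 0 <= c by exact: sqrtr_ge0.
rewrite normrM (ger0_norm (heat_kernel_ge0 _ _)) /phi1 2!normrM (ger0_norm c0) (gtr0_norm x0).
have C0 : 0 <= C.
  have := le_trans (normr_ge0 _) (phiC x0).
  by rewrite pmulr_lge0// mulr_gt0 ?expR_gt0.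
apply: (@le_trans _ _ (C * (x * expR ((8 * T)^-1 * x ^+ 2)) * (c * x) * heat_kernel x xi)).
  by rewrite !ler_wpM2r ?heat_kernel_ge0 ?phiC ?mulr_ge0 ?(ltW x0).
rewrite /heat_kernel [leLHS](_ : _ = c * C * (x ^+ 2 *
  (expR ((8 * T)^-1 * x ^+ 2) * expR (- (x ^+ 2 / (4 * xi)))) / (2 * xi) `^ (3 / 2))); last by ring.
rewrite -expRD ler_wpM2l ?mulr_ge0// ler_wpM2r ?invr_ge0 ?powR_ge0//.
rewrite ler_wpM2l ?sqr_ge0// ler_expR.
have -> : x ^+ 2 / (4 * xi) = (8 * xi)^-1 * x ^+ 2 + (8 * xi)^-1 * x ^+ 2.
  by field; rewrite gt_eqF.
rewrite opprD addrA gerDr subr_le0.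
by rewrite ler_wpM2r ?sqr_ge0// lef_pV2 ?posrE ?mulr_gt0// ler_pM2l// ltW.
Qed.

(** The exponent 2 * 1 matches [integral_gauss_heat] at n = 0. *)
Let majorant xi x : R :=
  x ^+ (2 * 1) * expR (- ((8 * xi)^-1 * x ^+ 2)) / (2 * xi) `^ (3 / 2).

Let Q : R := Num.sqrt (pi * 8 / 2).

(** For b = 8 and n = 0 the integral is independent of xi, so integrating it over the bounded time
    interval stays finite. *)
Lemma integral_heat_majorant xi : I xi ->
  (\int[mu]_(x in D) (majorant xi x)%:E = Q%:E)%E.
Proof.
rewrite /= in_itv/= => /andP[xi0 xiT].
by rewrite integral_gauss_heat// muln0 add0n fact0 factS fact0 expr0 !mulr1 divff// divff ?mulr1.
Qed.

Lemma measurable_heat_majorant xi : measurable_fun D (majorant xi).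
Proof. by apply: measurable_funM => //; exact: measurable_gauss_monomial. Qed.

Lemma majorant_ge0 xi x : 0 <= majorant xi x.
Proof.
by rewrite divr_ge0 ?powR_ge0// mulr_ge0 ?expR_ge0// exprM exprn_ge0// sqr_ge0.
Qed.

Lemma integrable_heat_majorant xi : I xi -> mu.-integrable D (EFin \o majorant xi).
Proof.
move=> Ixi; apply/integrableP; split.
  by apply/measurable_EFinP; exact: measurable_heat_majorant.
under eq_integral do rewrite /= ger0_norm ?majorant_ge0//.
by rewrite integral_heat_majorant ?ltry.
Qed.

Lemma measurable_phi1 : measurable_fun D phi1.
Proof. by apply: measurable_funM => //; exact: measurable_funM. Qed.

Lemma integrable_heat_slice xi : I xi ->
  mu.-integrable D (fun x => (phi1 x * heat_kernel x xi)%:E).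
Proof.
move=> Ixi; apply: (le_integrable _ _ _ (integrableZl _ (c * C) (integrable_heat_majorant Ixi))) => //.
  apply/measurable_EFinP; apply: measurable_funM; first exact: measurable_phi1.
  exact: measurable_heat_kernelx.
move=> x; rewrite /= in_itv/= andbT => x0.
by rewrite lee_fin (le_trans (heat_integrand_le x0 Ixi))// ler_norm.
Qed.

Let muI : mu I = T%:E.
Proof. by rewrite [LHS](lebesgue_measure_itv `]0, T[)/= lte_fin T0 sube0. Qed.

Lemma integrable_heat_kernel x : 0 < x ->
  mu.-integrable I (fun xi => (heat_kernel x xi * v xi)%:E).
Proof.
move=> x0; have [B B0 leB] := heat_kernel_bounded x0.
apply: measurable_bounded_integrable => //.
- by rewrite [X in (X < _)%E]muI ltry.
- by apply: measurable_funM => //; exact: measurable_heat_kernelxi.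
- exists (B * M); split; first exact: num_real.
  move=> e Me xi Ixi; apply/ltW/(le_lt_trans _ Me).
  rewrite normrM ger0_norm ?heat_kernel_ge0// ler_pM ?heat_kernel_ge0 ?vM//.
  by rewrite leB//; move: Ixi; rewrite /= in_itv/= => /andP[].
Qed.

(** Extension by zero to the plane, so that Fubini applies on the full product. *)
Let f (z : measurableTypeR R * measurableTypeR R) : \bar R :=
  ((phi1 \_ D) z.1 * heat_kernel z.1 z.2 * (v \_ I) z.2)%:E.

Lemma measurable_heat_integrand : measurable_fun setT f.
Proof.
apply/measurable_EFinP; apply: measurable_funM.
  apply: measurable_funM; last exact: measurable_heat_kernel.
  apply: (measurableT_comp _ measurable_fst).
  by apply/(measurable_restrictT _ _).1 => //; exact: measurable_phi1.
apply: (measurableT_comp _ measurable_snd).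
exact/(measurable_restrictT _ _).1.
Qed.

(** Tonelli, integrating in x first: every slice is at most M c C Q, and the time interval has
    length T. *)
Lemma integrable_heat_integrand :
  (@lebesgue_measure R \x @lebesgue_measure R)%E.-integrable setT f.
Proof.
apply/integrable21ltyP; first exact: measurable_heat_integrand.
apply: (@le_lt_trans _ _ (\int[mu]_(xi in I) (M * (c * C * Q))%:E)%E); last first.
  by rewrite integral_cst// [X in (_ * X < _)%E]muI -EFinM ltry.
rewrite [leRHS]integral_mkcond; apply: ge0_le_integral => //.
- by move=> xi _; apply: integral_ge0.
- have mf := measurableT_comp (@abse_measurable R setT) measurable_heat_integrand.
  by apply: (measurable_fun_fubini_tonelli_G (abse \o f)) => [|z]; [exact: mf|exact: abse_ge0].
- by apply/(measurable_restrictT _ _).1.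
move=> xi _; rewrite patchE; case: ifPn => xiI; last first.
  rewrite integral0_eq// => x _.
  by rewrite /f /= [X in _ * X]patchE (negPf xiI) mulr0 normr0.
have Ixi : I xi by rewrite inE in xiI.
have M0 : 0 <= M := le_trans (normr_ge0 _) (vM Ixi).
have -> : ((M * (c * C * Q))%:E = \int[mu]_(x in D) ((M * (c * C))%:E * (majorant xi x)%:E))%E.
  rewrite integralZl//; last exact: integrable_heat_majorant.
  by rewrite integral_heat_majorant// -EFinM -!mulrA.
rewrite [leRHS]integral_mkcond; apply: ge0_le_integral => //.
- have := measurableT_comp (@abse_measurable R setT) measurable_heat_integrand.
  by move=> /measurableT_comp; apply; exact: measurable_pair2.
- apply/(measurable_restrictT _ _).1 => //; apply/measurable_EFinP.
  by apply: measurable_funM => //; exact: measurable_heat_majorant.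
move=> x _; rewrite /f/= !patchE xiI; case: ifPn => xD; last by rewrite mul0r mul0r normr0.
rewrite -EFinM lee_fin normrM mulrC -[leRHS]mulrA ler_pM ?vM//.
by apply: heat_integrand_le => //; rewrite inE /= in_itv/= andbT in xD.
Qed.

Lemma fubini_F_heat x : fubini_F mu f x =
  ((fun x => (phi x * heat_state T v x)%:E) \_ D) x.
Proof.
rewrite /fubini_F patchE; case: ifPn => xD; last first.
  by rewrite integral0_eq// => xi _; rewrite /f/= patchE (negPf xD) !mul0r.
have x0 : 0 < x by rewrite inE /= in_itv/= andbT in xD.
transitivity (\int[mu]_(xi in I) ((phi1 x)%:E * (heat_kernel x xi * v xi)%:E))%E.
  rewrite [RHS]integral_mkcond; apply: eq_integral => xi _.
  rewrite /f/= !patchE xD; case: ifP => _; last by rewrite mulr0.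
  by rewrite -EFinM -mulrA.
rewrite integralZl//; last exact: integrable_heat_kernel.
(* [heat_state] uses the real-valued integral, which agrees with the extended one only when the
   latter is finite. *)
have := integrable_fin_num _ (integrable_heat_kernel x0) => /(_ _)/fineK <-//.
by rewrite -EFinM /phi1 /heat_state [in RHS]mulrA.
Qed.

Lemma fubini_G_heat xi : fubini_G mu f xi =
  ((fun xi => (v xi)%:E * \int[mu]_(x in D) (phi1 x * heat_kernel x xi)%:E)%E \_ I) xi.
Proof.
rewrite /fubini_G patchE; case: ifPn => xiI; last first.
  by rewrite integral0_eq// => x _; rewrite /f/= [X in _ * X]patchE (negPf xiI) mulr0.
have Ixi : I xi by rewrite inE in xiI.
rewrite -integralZl//; last exact: integrable_heat_slice.
rewrite [RHS]integral_mkcond; apply: eq_integral => x _.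
rewrite /f/= !patchE xiI; case: ifP => _; last by rewrite !mul0r.
by rewrite -EFinM mulrC.
Qed.

Lemma integrable_mul_heat_state :
  mu.-integrable D (fun x => (phi x * heat_state T v x)%:E).
Proof.
have := integrable_fubini_F integrable_heat_integrand.
rewrite (_ : fubini_F _ _ = (fun x => (phi x * heat_state T v x)%:E) \_ D).
  by move=> ?; apply/(integrable_mkcond _ _).2.
by apply/funext => x; rewrite fubini_F_heat.
Qed.

(** Fubini as a duality: testing a heat state against [phi] amounts to testing the control against
    the transform [m] of [phi]. *)
Lemma integral_mul_heat_state (m : R -> R) :
  (forall xi, I xi -> (\int[mu]_(x in D)
    (phi x * (Num.sqrt (2 / pi) * x) * heat_kernel x xi)%:E = (m xi)%:E)%E) ->
  (\int[mu]_(x in D) (phi x * heat_state T v x)%:E =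
   \int[mu]_(xi in I) (m xi * v xi)%:E)%E.
Proof.
move=> mE.
transitivity (\int[mu]_x fubini_F mu f x)%E.
  by rewrite integral_mkcond; apply: eq_integral => x _; rewrite fubini_F_heat.
transitivity (\int[mu]_x fubini_G mu f x)%E.
  exact: (Fubini integrable_heat_integrand).
rewrite [RHS]integral_mkcond; apply: eq_integral => xi _.
rewrite fubini_G_heat !patchE; case: ifPn => // xiI.
have Ixi : I xi by rewrite inE in xiI.
rewrite (_ : (\int[mu]_(x in D) _)%E = (m xi)%:E); last exact: mE.
by rewrite -EFinM mulrC.
Qed.

End heat_fubini.

(** * Moments of heat states, and the two implications for real components *)

Section heat_moments.
Variable R : realType.
Local Notation mu := (@lebesgue_measure R).
Local Notation D := ([set` `]0%R, +oo[] : set (measurableTypeR R)).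
Variables (T L : R).
Local Notation I := ([set` `]0, T[] : set (measurableTypeR R)).
Hypotheses (T0 : 0 < T) (L0 : 0 < L).

Lemma expr_odd_le n : exists2 C, 0 < C &
  forall x : R, 0 < x -> `|x ^+ (2 * n + 1)| <= C * (x * expR ((8 * T)^-1 * x ^+ 2)).
Proof.
have [|C C0 leC] := @exprn_le_expR_sqr R (8 * T)^-1 (2 * n); first by rewrite invr_gt0 mulr_gt0.
exists C => // x x0; have := leC x; rewrite !gtr0_norm ?exprn_gt0// => le.
by rewrite addn1 exprS mulrCA ler_pM2l.
Qed.

Lemma integrable_moment_heat_state (v : R -> R) n :
  measurable_fun I v -> (forall xi, I xi -> `|v xi| <= L) ->
  mu.-integrable D (fun x => (x ^+ (2 * n + 1) * heat_state T v x)%:E).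
Proof.
move=> mv vL; have [C C0 leC] := expr_odd_le n.
by apply: (integrable_mul_heat_state T0 _ leC mv vL); exact: exprn_measurable.
Qed.

Lemma moment_heat_state_bounded (v : R -> R) n :
  measurable_fun I v -> (forall xi, I xi -> `|v xi| <= L) ->
  (\int[mu]_(x in D) (x ^+ (2 * n + 1) * heat_state T v x)%:E =
   \int[mu]_(xi in I) ((2 * n + 1)`!%:R / n`!%:R * xi ^+ n * v xi)%:E)%E.
Proof.
move=> mv vL; have [C C0 leC] := expr_odd_le n.
apply: (integral_mul_heat_state T0 _ leC mv vL); first exact: exprn_measurable.
move=> xi; rewrite /= in_itv/= => /andP[xi0 xiT].
have := @integral_gauss_heat R xi 4 n xi0 (ltr0Sn _ _).
move=> /(congr1 (fun z => (Num.sqrt (2 / pi))%:E * z)%E).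
rewrite -ge0_integralZl//; last 2 first.
- apply/measurable_EFinP; apply: measurable_funM => //.
  exact: measurable_gauss_monomial.
- move=> x _; rewrite lee_fin divr_ge0 ?powR_ge0// mulr_ge0 ?expR_ge0//.
  by rewrite exprM exprn_ge0// sqr_ge0.
rewrite -EFinM => E; transitivity (\int[mu]_(x in D) ((Num.sqrt (2 / pi))%:E *
    (x ^+ (2 * n.+1) * expR (- ((4 * xi)^-1 * x ^+ 2)) / (2 * xi) `^ (3 / 2))%:E))%E.
  apply: eq_integral => x _; rewrite -EFinM; congr EFin.
  rewrite (_ : (2 * n.+1)%N = (2 * n + 1).+1); last by rewrite mulnS addn1.
  by rewrite /heat_kernel [x ^+ (2 * n + 1).+1]exprS [_ / (4 * xi)]mulrC; ring.
rewrite E; congr EFin; rewrite [4 * xi / 4]mulrAC divff// mul1r.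
(* The two square roots multiply to sqrt(4) = 2, which cancels b/8 = 1/2 at b = 4. *)
rewrite [LHS](_ : _ = Num.sqrt (2 / pi) * Num.sqrt (pi * 4 / 2) / 2 *
  ((2 * n + 1)`!%:R / n`!%:R * xi ^+ n)); last by field; rewrite pnatr_eq0 -lt0n fact_gt0.
rewrite -sqrtrM ?divr_ge0 ?pi_ge0//.
rewrite [2 / pi * _](_ : _ = 2 ^+ 2); last first.
  by rewrite -!mulrA mulKf ?gt_eqF ?pi_gt0//; field.
by rewrite sqrtr_sqr ger0_norm// divff ?mul1r.
Qed.

(** The Fubini argument assumes a pointwise bound on the control, whereas the essential bound holds
    only almost everywhere. Clamping the values to [-L, L] alters v on a null set only. *)
Lemma ae_bounded_clamp (v : R -> R) : measurable_fun I v ->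
  {ae mu, forall xi, I xi -> `|v xi| <= L} ->
  exists v' : R -> R, [/\ measurable_fun I v', (forall xi, I xi -> `|v' xi| <= L) &
    forall h : R -> R, measurable_fun I h ->
      \int[mu]_(xi in I) (h xi * v xi) = \int[mu]_(xi in I) (h xi * v' xi)].
Proof.
move=> mv vL; exists (fun xi => Num.max (- L) (Num.min L (v xi))).
have mv' : measurable_fun I (fun xi => Num.max (- L) (Num.min L (v xi))).
  by apply: measurable_maxr => //; exact: measurable_minr.
split=> // [xi _|h mh].
  rewrite ler_norml le_max lexx/= ge_max ge_min lexx/= andbT.
  by rewrite (@le_trans _ _ 0) ?oppr_le0 ?ltW.
(* Comparing the extended integrals asks only measurability of h. *)
congr fine; apply: ae_eq_integral => //.
- by apply/measurable_EFinP; exact: measurable_funM.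
- by apply/measurable_EFinP; exact: measurable_funM.
apply: filterS vL => xi vL Ixi; congr (_ * _)%:E.
have := vL Ixi; rewrite ler_norml => /andP[? ?].
by rewrite min_r// max_r.
Qed.

Lemma heat_state_eq (v v' : R -> R) :
  (forall h : R -> R, measurable_fun I h ->
    \int[mu]_(xi in I) (h xi * v xi) = \int[mu]_(xi in I) (h xi * v' xi)) ->
  heat_state T v =1 heat_state T v'.
Proof.
by move=> vv' x; rewrite /heat_state vv'//; exact: measurable_heat_kernelxi.
Qed.

(** The direct implication for one real component; the converse also applies it to the heat state
    itself. *)
Lemma moment_heat_state (v w : R -> R) n : measurable_fun I v ->
  {ae mu, forall xi, I xi -> `|v xi| <= L} -> measurable_fun D w ->
  {ae mu, forall x, 0 < x -> w x = heat_state T v x} ->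
  \int[mu]_(xi in I) (xi ^+ n * v xi) =
  n`!%:R / (2 * n + 1)`!%:R * \int[mu]_(x in D) (x ^+ (2 * n + 1) * w x).
Proof.
move=> mv vL mw wv; have [v' [mv' v'L vv']] := ae_bounded_clamp mv vL.
have mX : measurable_fun I (fun xi : R => xi ^+ n) by exact: exprn_measurable.
rewrite vv'//.
have -> : \int[mu]_(x in D) (x ^+ (2 * n + 1) * w x) =
    \int[mu]_(xi in I) ((2 * n + 1)`!%:R / n`!%:R * (xi ^+ n * v' xi)).
  congr fine; under [RHS]eq_integral do rewrite mulrA.
  rewrite -moment_heat_state_bounded//; apply: ae_eq_integral => //.
  - apply/measurable_EFinP; exact: measurable_funM.
  - exact: (measurable_int mu (integrable_moment_heat_state n mv' v'L)).
  apply: filterS wv; first exact: (ae_filter_ringOfSetsType mu).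
  move=> x wv; rewrite /= in_itv/= andbT => x0.
  by rewrite wv// (heat_state_eq vv').
rewrite RintegralZl//; last first.
  apply: measurable_bounded_integrable => //.
  - by rewrite [X in (X < _)%E](lebesgue_measure_itv `]0, T[)/= lte_fin T0 sube0 ltry.
  - exact: measurable_funM.
  exists (T ^+ n * L); split; first exact: num_real.
  move=> e Me xi Ixi; apply/ltW/(le_lt_trans _ Me).
  rewrite normrM normrX ler_pM ?v'L ?exprn_ge0//.
  move: Ixi; rewrite /= in_itv/= => /andP[xi0 /ltW xiT].
  by rewrite lerXn2r ?nnegrE ?gtr0_norm// ltW.
by rewrite -invf_div mulKf// mulf_neq0 ?invr_neq0// pnatr_eq0 -lt0n fact_gt0.
Qed.

(** The converse for one real component: w and the heat state of v have the same odd moments, so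
    [moments_sqr_eq0] applies to x times their difference. *)
Lemma heat_state_of_moments (v w : R -> R) : measurable_fun I v ->
  {ae mu, forall xi, I xi -> `|v xi| <= L} ->
  mu.-integrable D (fun x => (expR ((8 * T)^-1 * x ^+ 2) * w x)%:E) ->
  (forall n, \int[mu]_(xi in I) (xi ^+ n * v xi) =
    n`!%:R / (2 * n + 1)`!%:R * \int[mu]_(x in D) (x ^+ (2 * n + 1) * w x)) ->
  {ae mu, forall x, 0 < x -> w x = heat_state T v x}.
Proof.
move=> mv vL iw mom; have [v' [mv' v'L vv']] := ae_bounded_clamp mv vL.
(* The factor x turns odd moments of w - h into even moments of G. *)
pose h := heat_state T v'; pose G x := x * (w x - h x).
(* Half of the available rate 1/(8T); the other half absorbs the factor x in G. *)
pose a := (16 * T)^-1.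
have a0 : 0 < a by rewrite invr_gt0 mulr_gt0.
have aT : (8 * T)^-1 = a + a by rewrite /a; field; rewrite gt_eqF.
have T80 : 0 < (8 * T)^-1 by rewrite invr_gt0 mulr_gt0.
pose y (x : measurableTypeR R) : R := x ^+ 2.
have my A : measurable_fun (A : set (measurableTypeR R)) y by exact: exprn_measurable.
have mexp A b : measurable_fun (A : set (measurableTypeR R)) (fun x : R => expR (b * x ^+ 2)).
  by apply: measurableT_comp => //; apply: measurable_funM => //; exact: exprn_measurable.
have xw (g : R -> R) n : mu.-integrable D (fun x => (expR ((8 * T)^-1 * x ^+ 2) * g x)%:E) ->
    mu.-integrable D (fun x => (x ^+ n * g x)%:E).
  move=> ig; have [C C0 leC] := exprn_le_expR_sqr n T80.
  apply: (@exp_integrable_mul _ _ _ mu D y _ _ _ g (fun x : R => x ^+ n) C ig) => //.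
  by move=> x _; rewrite normrX leC.
have iG : exp_integrable mu D y a G.
  pose k x : R := expR (a * x ^+ 2) * x.
  have ikw : mu.-integrable D (fun x => (k x * w x)%:E).
    have [C C0 leC] := exprn_le_expR_sqr 1 a0.
    apply: (@exp_integrable_mul _ _ _ mu D y _ _ _ w k C iw) => //.
      exact: measurable_funM.
    move=> x _; rewrite normrM (ger0_norm (expR_ge0 _)) aT mulrDl expRD mulrC mulrA.
    by rewrite ler_wpM2r ?expR_ge0// leC.
  (* Fubini with [phi] = k and C = 1, as a <= 1/(8T). *)
  have ikh : mu.-integrable D (fun x => (k x * h x)%:E).
    apply: (@integrable_mul_heat_state R T 1 L k v' T0 _ _ mv' v'L).
      exact: measurable_funM.
    move=> x x0; rewrite mul1r /k gtr0_norm ?mulr_gt0 ?expR_gt0// [leLHS]mulrC ler_pM2l//.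
    by rewrite ler_expR ler_wpM2r ?sqr_ge0// aT lerDl ltW.
  rewrite /exp_integrable (_ : (fun x => _) =
      ((fun x => (k x * w x)%:E) \- (fun x => (k x * h x)%:E))%E).
    exact: integrableB.
  by apply/funext => x; rewrite -EFinB; congr EFin; rewrite /G /k /y; ring.
have momG n : (\int[mu]_(x in D) (x ^+ (2 * n) * G x)%:E = 0)%E.
  have iwn := xw w (2 * n + 1)%N iw.
  have ihn := integrable_moment_heat_state n mv' v'L.
  transitivity (\int[mu]_(x in D) ((x ^+ (2 * n + 1) * w x)%:E -
      (x ^+ (2 * n + 1) * h x)%:E))%E.
    by apply: eq_integral => x _; rewrite -EFinB; congr EFin; rewrite /G exprD expr1; ring.
  rewrite integralB//.
  rewrite -(fineK (integrable_fin_num _ iwn))// -(fineK (integrable_fin_num _ ihn))//.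
  rewrite -EFinB; congr EFin; apply/eqP; rewrite subr_eq0; apply/eqP.
  have f0 : n`!%:R / (2 * n + 1)`!%:R != 0 :> R.
    by rewrite mulf_neq0 ?invr_neq0// pnatr_eq0 -lt0n fact_gt0.
  apply: (mulfI f0).
  (* After scaling, both sides equal the n-th moment of v: one by hypothesis, the other by the
     direct implication applied to h. *)
  rewrite -[LHS]mom -(moment_heat_state n mv vL)//.
  (* Measurability of h comes from that of the integrable function x h, divided by x > 0. *)
  - apply: (eq_measurable_fun (fun x : R => x^-1 * (x ^+ (2 * 0 + 1) * h x))) => [x|].
      by rewrite inE/= in_itv/= andbT => x0; rewrite expr1 mulKf// gt_eqF.
    apply: measurable_funM; first exact: measurable_funTS (@measurable_invr R).
    have ih0 := integrable_moment_heat_state 0 mv' v'L.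
    by apply/measurable_EFinP; exact: (measurable_int mu ih0).
  - by apply: aeW => x _; rewrite /h (heat_state_eq vv').
have := moments_sqr_eq0 a0 iG momG.
apply: filterS; first exact: (ae_filter_ringOfSetsType mu).
move=> x Gx x0; have /eqP := Gx x0.
by rewrite /G mulf_eq0 gt_eqF//= subr_eq0 /h (heat_state_eq vv') => /eqP.
Qed.

End heat_moments.

(** * Complex-valued states *)

Local Open Scope complex_scope.

Lemma modulusE (R : realType) (z : R[i]) :
  modulus z = Num.sqrt (complex.Re z ^+ 2 + complex.Im z ^+ 2).
Proof. by rewrite /modulus normc_def. Qed.

Lemma Re_le_modulus (R : realType) (z : R[i]) : `|complex.Re z| <= modulus z.
Proof. by rewrite modulusE -sqrtr_sqr ler_wsqrtr// lerDl sqr_ge0. Qed.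

Lemma Im_le_modulus (R : realType) (z : R[i]) : `|complex.Im z| <= modulus z.
Proof. by rewrite modulusE -sqrtr_sqr ler_wsqrtr// lerDr sqr_ge0. Qed.

Lemma Re_realM (R : realType) (a : R) (z : R[i]) : complex.Re (a%:C * z) = a * complex.Re z.
Proof. by case: z => x y /=; rewrite mul0r subr0. Qed.

Lemma Im_realM (R : realType) (a : R) (z : R[i]) : complex.Im (a%:C * z) = a * complex.Im z.
Proof. by case: z => x y /=; rewrite mul0r addr0. Qed.

Lemma Cintegral_realM (R : realType) (D : set R) (a : R -> R) (f : R -> R[i]) :
  Cintegral D (fun x => (a x)%:C * f x) =
  (\int[lebesgue_measure]_(x in D) (a x * complex.Re (f x))) +i*
  (\int[lebesgue_measure]_(x in D) (a x * complex.Im (f x))).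
Proof.
by congr (_ +i* _); apply: eq_Rintegral => x _; rewrite ?Re_realM ?Im_realM.
Qed.

Lemma omegaE (R : realType) (W : R -> R[i]) n : omega W n =
  (n`!%:R / (2 * n + 1)`!%:R *
    \int[lebesgue_measure]_(x in `]0%R, +oo[) (x ^+ (2 * n + 1) * complex.Re (W x))) +i*
  (n`!%:R / (2 * n + 1)`!%:R *
    \int[lebesgue_measure]_(x in `]0%R, +oo[) (x ^+ (2 * n + 1) * complex.Im (W x))).
Proof.
rewrite /omega (_ : _ / _ = (n`!%:R / (2 * n + 1)`!%:R)%:C); last first.
  by rewrite rmorphM fmorphV !rmorph_nat.
by rewrite Cintegral_realM; apply/eqP; rewrite eq_complex Re_realM Im_realM !eqxx.
Qed.

Lemma heat_stateE (R : realType) (T x : R) (v : R -> R[i]) :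
  (Num.sqrt (2 / pi) * x)%:C * Cintegral `]0, T[ (fun xi =>
    (expR (- (x ^+ 2 / (4 * xi))))%:C * v xi / ((2 * xi) `^ (3 / 2))%:C) =
  heat_state T (@complex.Re R \o v) x +i* heat_state T (@complex.Im R \o v) x.
Proof.
rewrite [Cintegral _ _](_ : _ = Cintegral `]0, T[ (fun xi => (heat_kernel x xi)%:C * v xi)).
  by rewrite Cintegral_realM; apply/eqP; rewrite eq_complex Re_realM Im_realM !eqxx.
congr Cintegral; apply/funext => xi.
by rewrite mulrAC /heat_kernel [in RHS]rmorphM fmorphV.
Qed.

Lemma heat_stateN (R : realType) (T : R) (v : R -> R) (x : R) :
  heat_state T v (- x) = - heat_state T v x.
Proof.
rewrite /heat_state mulrN mulNr; congr (- (_ * _)).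
by apply: eq_Rintegral => xi _; rewrite /heat_kernel sqrrN.
Qed.

Lemma Lp_norm_pinfty_le (R : realType) (D : set R) (f : R -> R[i]) (L : R) :
  (Lp_norm +oo D f <= L%:E)%E ->
  {ae @lebesgue_measure R, forall x, D x -> modulus (f x) <= L}.
Proof.
rewrite /Lp_norm Lnorm.unlock.
(* The norm at infinite exponent is an essential supremum only when the whole space has positive
   measure; the unit interval shows this. *)
have -> : (0 < @lebesgue_measure R setT)%E.
  rewrite (@lt_le_trans _ _ (@lebesgue_measure R `[0%R, 1%R]))//.
    by rewrite lebesgue_measure_itv/= lte01 sube0 lte01.
  by apply: le_measure; rewrite ?inE.
move=> /ess_supP; apply: filterS => x /=.
by rewrite patchE => + Dx; rewrite mem_set//= lee_fin; apply: le_trans; exact: ler_norm.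
Qed.

(** Reflection preserves Lebesgue measure, hence null sets. *)
Lemma ae_opp (R : realType) (P : R -> Prop) :
  {ae @lebesgue_measure R, forall x, P x} ->
  {ae @lebesgue_measure R, forall x, P (- x)}.
Proof.
move=> [N [mN N0 PN]].
have := lebesgue_measureN mN; rewrite N0 => N0'.
exists (-%R @^-1` N); split => //; last by move=> x /PN.
by rewrite -[X in measurable X]setTI; exact: oppr_measurable.
Qed.

(** For x < 0 use the equality at -x; the point 0 is null. *)
Lemma odd_ae_eq (R : realType) (V : zmodType) (f g : R -> V) :
  {ae @lebesgue_measure R, forall x, f (- x) = - f x} ->
  (forall x, g (- x) = - g x) ->
  {ae @lebesgue_measure R, forall x, 0 < x -> f x = g x} ->
  {ae @lebesgue_measure R, forall x, f x = g x}.
Proof.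
move=> oddf oddg fg.
have nz : {ae @lebesgue_measure R, forall x, x != 0}.
  exists [set 0%R]; split => //; first exact: lebesgue_measure_set1.
  by move=> x /= /negP; rewrite negbK => /eqP.
have aeF := ae_filter_ringOfSetsType (@lebesgue_measure R).
have := @filterI _ _ aeF _ _ oddf
  (@filterI _ _ aeF _ _ nz (@filterI _ _ aeF _ _ fg (ae_opp fg))).
apply: (@filterS _ _ aeF) => x [fN [x0 [fgx fgNx]]].
have [/fgx//|x_lt0|x00] := ltgtP 0 x; last by rewrite -x00 eqxx in x0.
by apply: oppr_inj; rewrite -fN -oddg fgNx// oppr_gt0.
Qed.

(** [p] stands for the real or the imaginary part, both dominated by the modulus. *)
Lemma integrable_weighted_component (R : realType) (W : R -> R[i]) (p : R[i] -> R) (b : R) :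
  measurable_fun setT (fun x => complex.Re (W x)) ->
  measurable_fun setT (fun x => complex.Im (W x)) ->
  measurable_fun setT (fun x => p (W x)) -> (forall z, `|p z| <= modulus z) ->
  (\int[@lebesgue_measure R]_(x in `]0%R, +oo[) (expR (b * x ^+ 2) * modulus (W x))%:E < +oo)%E ->
  (@lebesgue_measure R).-integrable `]0%R, +oo[ (fun x => (expR (b * x ^+ 2) * p (W x))%:E).
Proof.
move=> mRe mIm mp lep fin.
have me : measurable_fun setT (fun x : measurableTypeR R => expR (b * x ^+ 2)).
  by apply: measurableT_comp => //; apply: measurable_funM => //; exact: exprn_measurable.
have mm : measurable_fun setT (fun x => modulus (W x)).
  under eq_fun do rewrite modulusE.
  apply: (measurableT_comp (continuous_measurable_fun (@sqrt_continuous R))).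
  by apply: measurable_funD; exact: measurable_funX.
apply/integrableP; split.
  by apply: measurable_funTS; apply/measurable_EFinP; exact: measurable_funM.
apply: le_lt_trans fin; apply: ge0_le_integral => //.
- by apply: measurable_funTS; apply/measurable_EFinP; apply: measurableT_comp => //; exact: measurable_funM.
- by apply: measurable_funTS; apply/measurable_EFinP; exact: measurable_funM.
- by move=> x _; rewrite lee_fin normrM ger0_norm ?expR_ge0// ler_wpM2l ?expR_ge0.
Qed.

Theorem theorem4p4 (R : realType) (k : scalar_field) (T L : R)
    (hT : 0 < T) (hL : 0 < L) (W : R -> R[i]) (hW : odd_L2 k W)
    (hgrowth : forall T' : R, T < T' ->
      (\int[lebesgue_measure]_(x in `]0%R, +oo[)
          (expR (x ^+ 2 / (4 * T')) * modulus (W x))%:E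
        <= (L * Num.sqrt (T' / pi) *
            ln ((Num.sqrt T' + Num.sqrt T) /
                (Num.sqrt T' - Num.sqrt T)))%:E)%E) :
  reachable_from_zero k T L W <->
  exists v : R -> R[i],
    [/\ Lp k +oo%E `]0, T[ v,
        (Lp_norm +oo%E `]0%R, T[ v <= L%:E)%E &
        forall n : nat,
          Cintegral `]0, T[ (fun xi => (xi ^+ n)%:C * v xi) = omega W n].
Proof.
have [[_ mRe mIm _] Wodd] := hW.
have aeF := ae_filter_ringOfSetsType (@lebesgue_measure R).
have bound v (p : R[i] -> R) : (forall z, `|p z| <= modulus z) ->
    (Lp_norm +oo%E `]0%R, T[ v <= L%:E)%E ->
    {ae @lebesgue_measure R, forall xi, `]0%R, T[%classic xi -> `|(p \o v) xi| <= L}.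
  move=> lep /Lp_norm_pinfty_le; apply: filterS => xi le Ixi.
  exact: le_trans (lep _) (le Ixi).
split=> [[_ [v [Lpv vL Wv]]]|[v [Lpv vL mom]]].
- exists v; split => // n; have [_ mvRe mvIm _] := Lpv.
  rewrite omegaE Cintegral_realM; congr (_ +i* _).
    apply: (moment_heat_state hT hL n mvRe (bound _ _ (@Re_le_modulus R) vL)).
      exact: measurable_funTS.
    by apply: filterS Wv => x -> _; rewrite heat_stateE.
  apply: (moment_heat_state hT hL n mvIm (bound _ _ (@Im_le_modulus R) vL)).
    exact: measurable_funTS.
  by apply: filterS Wv => x -> _; rewrite heat_stateE.
- split => //; exists v; split => //; have [_ mvRe mvIm _] := Lpv.
  have fin : (\int[@lebesgue_measure R]_(x in `]0%R, +oo[)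
      (expR ((8 * T)^-1 * x ^+ 2) * modulus (W x))%:E < +oo)%E.
    (* At T' = 2T the growth hypothesis has weight exp(x^2/(8T)) and a finite right-hand side. *)
    have T2 : T < 2 * T by lra.
    apply: le_lt_trans (ltry _); apply: le_trans (hgrowth _ T2).
    rewrite le_eqVlt; apply/orP; left; apply/eqP; apply: eq_integral => x _.
    by congr (expR _ * _)%:E; field; rewrite gt_eqF.
  have Re0 : {ae @lebesgue_measure R, forall x, 0 < x ->
      complex.Re (W x) = heat_state T (@complex.Re R \o v) x}.
    apply: (heat_state_of_moments hT hL mvRe (bound _ _ (@Re_le_modulus R) vL)).
      exact: integrable_weighted_component (@Re_le_modulus R) fin.
    move=> n; have := mom n; rewrite omegaE Cintegral_realM => /eqP.
    by rewrite eq_complex => /andP[/eqP].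
  have Im0 : {ae @lebesgue_measure R, forall x, 0 < x ->
      complex.Im (W x) = heat_state T (@complex.Im R \o v) x}.
    apply: (heat_state_of_moments hT hL mvIm (bound _ _ (@Im_le_modulus R) vL)).
      exact: integrable_weighted_component (@Im_le_modulus R) fin.
    move=> n; have := mom n; rewrite omegaE Cintegral_realM => /eqP.
    by rewrite eq_complex => /andP[_ /eqP].
  (* Oddness, almost everywhere for W and everywhere for heat states, extends the equality from x >
     0 to the line. *)
  suff : {ae @lebesgue_measure R, forall x,
      W x = heat_state T (@complex.Re R \o v) x +i* heat_state T (@complex.Im R \o v) x}.
    by apply: filterS => x ->; rewrite heat_stateE.
  apply: odd_ae_eq => //.
    by move=> x; rewrite !heat_stateN.
  apply: filterS2 Re0 Im0 => x Rex Imx x0.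
  by apply/eqP; rewrite eq_complex/= Rex// Imx// !eqxx.
Qed.
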